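(* There exists a minimal action of the free semi-group with two generators $\mathbb{F}_{2}^{+}$ on a complex separable infinite-dimensional Hilbert space $H$; that is, there exist such an $H$ and two bounded linear operators $T_{0},T_{1}$ on $H$ such that for every non-zero vector $x\in H$ the set $\{T_{\omega_{0}}T_{\omega_{1}}\cdots T_{\omega_{n}}x : n\ge 0,\ (\omega_{0},\dots,\omega_{n})\in\{0,1\}^{n+1}\}$ is dense in $H$.
   Context: $\mathbb{F}_{2}^{+}$ is the set of all finite sequences $(\omega_{0},\dots,\omega_{n})$, $n\ge 0$, of zeroes and ones, with concatenation as the operation. Two bounded linear operators $T_{0},T_{1}$ on $H$ define an action $\rho$ of $\mathbb{F}_{2}^{+}$ on $H$ by $\rho((\omega_{0},\dots,\omega_{n}),x)=T_{\omega_{0}}\cdots T_{\omega_{n}}x$. The action $\rho$ is called minimal if for every non-zero vector $x\in H$ the orbit $\{\rho(\omega,x) : \omega\in\mathbb{F}_{2}^{+}\}$ is dense in $H$ (for the norm topology). *)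

(* Defs.v *)
From HB Require Import structures.
From mathcomp Require Import all_boot all_order all_algebra.
From mathcomp Require Import sesquilinear complex.
From mathcomp Require Import all_classical all_reals all_analysis.

Set Implicit Arguments.
Unset Strict Implicit.
Unset Printing Implicit Defensive.

Import Order.TTheory GRing.Theory Num.Theory.
Import numFieldNormedType.Exports.

Local Open Scope classical_set_scope.
Local Open Scope ring_scope.

(* The norm of a normed module over R[i] takes its values in R[i], hence
   [hnormE] is an equation between (nonnegative real) complex numbers. The
   inner product is linear in its first argument and conjugate-linear in the
   second one. *)
Record hilbertType (R : realType) := HilbertType {
  hsort :> completeNormedModType R[i];
  hdot : {dot hsort for (@Num.conj R[i])};
  hnormE : forall x : hsort, `|x| ^+ 2 = hdot x x }.

Definition separable (T : topologicalType) :=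
  exists2 D : set T, countable D & dense D.

Definition finite_dimensional (K : fieldType) (V : lmodType K) :=
  exists n (e : 'I_n -> V),
    forall v : V, exists a : 'I_n -> K, v = \sum_(i < n) a i *: e i.

(* The order of R[i] is partial: the inequality forces M to be a nonnegative
   real number as soon as V is nonzero. *)
Definition bounded_operator (R : realType) (V : normedModType R[i])
    (T : V -> V) :=
  exists M : R[i], forall x : V, `|T x| <= M * `|x|.

(* The free semigroup on two generators: non-empty binary words, where false
   stands for the letter 0 and true for the letter 1. *)
Definition F2plus := {w : seq bool | w != [::]}.

Definition F2plus_mul (v w : F2plus) : F2plus :=
  exist _ (val v ++ val w)
    (ltac:(by case: v w => [[|b v] nv] [w nw]) : val v ++ val w != [::]).

Section action.
Variables (V : Type) (T0 T1 : V -> V).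

(* The last letter of w acts first. *)
Definition rho (w : F2plus) (x : V) : V :=
  foldr (fun b y => if b then T1 y else T0 y) x (val w).

Lemma rhoM v w x : rho (F2plus_mul v w) x = rho v (rho w x).
Proof. by rewrite /rho /= foldr_cat. Qed.

End action.

Definition minimal (R : realType) (V : normedModType R[i]) (T0 T1 : V -> V) :=
  forall x : V, x != 0 -> dense (range (fun w => rho T0 T1 w x)).

(* Main.v *)
(* Let B be the backward shift of l2 and let d be a hypercyclic vector of the
   Rolewicz operator T0 = 16 B, i.e. a vector whose T0-orbit is dense; take
   T1 x = x_0 d. A nonzero x has some coordinate x_j <> 0, and then
   T0^n T1 T0^j x = (16^j x_j) T0^n d, which runs over a dense set when n varies.
   The vector d is explicit: its block of indices [2^l, 2^(l+1)) holds the l-th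
   finite sequence of rational complex numbers, scaled by 16^(-2^l). Thus
   T0^(2^l) d starts with the l-th sequence, and the next blocks contribute a
   tail that vanishes as l grows. *)

Require Import Defs.
From HB Require Import structures.
From mathcomp Require Import all_boot all_order all_algebra.
From mathcomp Require Import sesquilinear complex.
From mathcomp Require Import ring lra zify.
From mathcomp Require Import all_classical all_reals all_analysis.

Set Implicit Arguments.
Unset Strict Implicit.
Unset Printing Implicit Defensive.

Import Order.TTheory GRing.Theory Num.Theory.
Import numFieldNormedType.Exports.
Local Open Scope classical_set_scope.
Local Open Scope ring_scope.

(** * Cauchy-Schwarz and triangle inequalities for a dot product *)

Section DotNorm.
Variables (C : numClosedFieldType) (U : lmodType C).
Variable form : {dot U for @Num.conj C}.

(* The library has this inequality and the next one only over a
   finite-dimensional [vectType]. *)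
Lemma dot_CauchySchwarz u v : `|form u v| ^+ 2 <= form u u * form v v.
Proof.
have [-> | nz_v] := eqVneq v 0;
  first by rewrite !linear0r normr0 expr0n ?mulr0.
have v_gt0 : 0 < form v v by rewrite dnorm_gt0.
(* [u1] is the component of [u] orthogonal to [v]; by Pythagoras [form u u] is at least the
   contribution of [a *: v]. *)
pose a := form u v / form v v; pose u1 := u - a *: v.
have ou : form u1 v = 0.
  by rewrite linearBl/= linearZl_LR/= /a divfK ?subrr // gt_eqF.
have -> : u = u1 + a *: v by rewrite subrK.
rewrite linearDl/= ou add0r linearZl_LR/= normrM (ger0_norm (ltW v_gt0)).
rewrite hnormDd/=; last by rewrite linearZr_LR/= ou mulr0.
by rewrite dnormZ exprMn mulrDl expr2 mulrA lerDr mulr_ge0 // dnorm_ge0.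
Qed.

Lemma dot_triangle u v :
  sqrtC (form (u + v) (u + v)) <= sqrtC (form u u) + sqrtC (form v v).
Proof.
have CS : `|form u v| <= sqrtC (form u u) * sqrtC (form v v).
  rewrite -(@ler_pXn2r _ 2) ?nnegrE ?mulr_ge0 ?sqrtC_ge0 ?dnorm_ge0 //.
  by rewrite exprMn !sqrtCK dot_CauchySchwarz.
rewrite -(@ler_pXn2r _ 2) ?nnegrE ?addr_ge0 ?sqrtC_ge0 ?dnorm_ge0 //.
rewrite sqrrD !sqrtCK addrAC dnormD lerD2l -mulr_natr.
(* The cross term [form u v] and its conjugate add up to twice the real part, which is at most the
   modulus. *)
rewrite -[_ + _](divfK (negbT (pnatr_eq0 C 2))) -/('Re _) ler_pM2r ?ltr0n //.
by apply: le_trans CS; have := leif_Re_Creal (form u v); rewrite ReE => -[].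
Qed.

End DotNorm.

(** * Complex series through their real and imaginary parts *)

Section ComplexSeries.
Variable R : realType.
Implicit Types (u v : nat -> R[i]) (z : R[i]).
Local Notation Re := complex.Re.
Local Notation Im := complex.Im.

(** The squared modulus, valued in [R] rather than [R[i]] so that the theory of real series with
    nonnegative terms applies. *)
Definition sqnorm z : R := Re z ^+ 2 + Im z ^+ 2.

Lemma sqnorm_ge0 z : 0 <= sqnorm z.
Proof. by rewrite addr_ge0 ?sqr_ge0. Qed.

Lemma sqnormM z z' : sqnorm (z * z') = sqnorm z * sqnorm z'.
Proof. by case: z z' => [a b] [c d]; rewrite /sqnorm /=; ring. Qed.

Lemma sqnormD z z' : sqnorm (z + z') <= 2 * sqnorm z + 2 * sqnorm z'.
Proof.
case: z z' => [a b] [c d]; rewrite /sqnorm /=.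
have := sqr_ge0 (a - c); have := sqr_ge0 (b - d); nra.
Qed.

Lemma sqnormN z : sqnorm (- z) = sqnorm z.
Proof. by case: z => [a b]; rewrite /sqnorm /= !sqrrN. Qed.

Lemma sqnorm_eq0 z : (sqnorm z == 0) = (z == 0).
Proof.
by case: z => a b; rewrite eq_complex /sqnorm/= paddr_eq0 ?sqr_ge0 // !sqrf_eq0.
Qed.

Definition csummable u :=
  cvgn (series (fun k => Re (u k))) /\ cvgn (series (fun k => Im (u k))).

Definition csum u : R[i] :=
  (limn (series (fun k => Re (u k))) +i* limn (series (fun k => Im (u k))))%C.

Lemma csumP (a : R[i]) u v : csummable u -> csummable v ->
  csummable (fun k => a * u k + v k) /\
  csum (fun k => a * u k + v k) = a * csum u + csum v.
Proof.
move=> [ur ui] [vr vi]; case: a => a b.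
(* The real and the imaginary part of [a * u + v] are both real combinations of this shape. *)
have lin (f g h : nat -> R) (c d : R) : cvgn (series f) -> cvgn (series g) ->
    cvgn (series h) -> series (fun k => c * f k + d * g k + h k) @ \oo -->
    c * limn (series f) + d * limn (series g) + limn (series h).
  move=> cf cg ch.
  rewrite (_ : series _ =
      (fun n => c * series f n + d * series g n + series h n)); last first.
    by apply/funext => n; rewrite /series/= !big_split/= -!mulr_sumr.
  apply: cvgD ch; apply: cvgD.
  - by apply: cvgM; [exact: cvg_cst|exact: cf].
  - by apply: cvgM; [exact: cvg_cst|exact: cg].
have E1 : (fun k => Re ((a +i* b)%C * u k + v k)) =
    (fun k => a * Re (u k) + (- b) * Im (u k) + Re (v k)).
  by apply/funext => k; case: (u k) (v k) => [? ?] [? ?] /=; ring.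
have E2 : (fun k => Im ((a +i* b)%C * u k + v k)) =
    (fun k => a * Im (u k) + b * Re (u k) + Im (v k)).
  by apply/funext => k; case: (u k) (v k) => [? ?] [? ?] /=; ring.
have c1 := lin _ _ _ a (- b) ur ui vr; have c2 := lin _ _ _ a b ui ur vi.
split; first by split; rewrite ?E1 ?E2; apply/cvg_ex; eexists; eassumption.
rewrite /csum E1 E2 (cvg_lim _ c1) // (cvg_lim _ c2) //.
by apply/eqP; rewrite eq_complex/=; apply/andP; split; apply/eqP; ring.
Qed.

End ComplexSeries.

(** * The space of square-summable sequences *)

Section l2.
Variable R : realType.
Local Notation Re := complex.Re.
Local Notation Im := complex.Im.
Local Notation C := R[i].

Definition l2_pred : {pred nat -> C} :=
  fun x => `[< cvgn (series (fun k => sqnorm (x k))) >].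

Lemma l2_predP (x : nat -> C) :
  reflect (cvgn (series (fun k => sqnorm (x k)))) (x \in l2_pred).
Proof. exact: asboolP. Qed.

(** Partial sums of nonnegative terms increase, so a uniform bound forces convergence and passes to
    the limit. *)
Lemma l2_of_bounded (x : nat -> C) (M : R) :
    (forall n, \sum_(0 <= k < n) sqnorm (x k) <= M) ->
  x \in l2_pred /\ limn (series (fun k => sqnorm (x k))) <= M.
Proof.
move=> xM; have cx : cvgn (series (fun k => sqnorm (x k))).
  apply: nondecreasing_is_cvgn.
    by apply: nondecreasing_series => n _ _; exact: sqnorm_ge0.
  by exists M => _ [n _ <-]; exact: xM.
split; first exact/l2_predP.
by apply: limr_le => //; near=> n; exact: xM.
Unshelve. all: by end_near. Qed.

Lemma l2_submod_closed : submod_closed l2_pred.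
Proof.
split.
  apply: (proj1 (@l2_of_bounded _ 0 _)) => n.
  by rewrite big1 // => i _; rewrite /sqnorm /= expr0n addr0.
move=> a u v /l2_predP cu /l2_predP cv; apply/l2_predP.
apply: (@series_le_cvg _ _
  (fun k => 2 * sqnorm a * sqnorm (u k) + 2 * sqnorm (v k))).
- by move=> n; exact: sqnorm_ge0.
- by move=> n; rewrite addr_ge0 ?mulr_ge0 ?sqnorm_ge0.
- by move=> n; apply: le_trans (sqnormD _ _) _; rewrite sqnormM mulrA.
- apply: (@is_cvg_seriesD _ (2 * sqnorm a *: (fun k => sqnorm (u k)))
    (2 *: (fun k => sqnorm (v k)))); exact: is_cvg_seriesZ.
Qed.

HB.instance Definition _ := GRing.isSubmodClosed.Build C _ l2_pred
  l2_submod_closed.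

Record l2 := L2 { l2val :> nat -> C; l2valP : l2val \in l2_pred }.
HB.instance Definition _ := [isSub for l2val].
HB.instance Definition _ := [Choice of l2 by <:].
HB.instance Definition _ := [SubChoice_isSubLmodule of l2 by <:].

Lemma l2_ext (x y : l2) : (forall k, x k = y k) -> x = y.
Proof. by move=> xy; apply: val_inj; apply/funext. Qed.

Lemma l2_cvg (x : l2) : cvgn (series (fun k => sqnorm (x k))).
Proof. exact/l2_predP/l2valP. Qed.

Definition l2sq (x : l2) : R := limn (series (fun k => sqnorm (x k))).

Lemma l2sq_partial (x : l2) n : \sum_(0 <= k < n) sqnorm (x k) <= l2sq x.
Proof.
apply: (@nondecreasing_cvgn_le _ (series (fun k => sqnorm (x k))));
  last exact: l2_cvg.
by apply: nondecreasing_series => k _ _; exact: sqnorm_ge0.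
Qed.

Lemma l2sq_le (x : l2) (M : R) :
  (forall n, \sum_(0 <= k < n) sqnorm (x k) <= M) -> l2sq x <= M.
Proof. by move=> /l2_of_bounded[]. Qed.

Lemma l2sq_ge0 (x : l2) : 0 <= l2sq x.
Proof. by have := l2sq_partial x 0; rewrite big_geq. Qed.

Lemma l2sq_coord (x : l2) k : sqnorm (x k) <= l2sq x.
Proof.
apply: le_trans (l2sq_partial x k.+1); rewrite big_nat_recr//= lerDr.
by rewrite sumr_ge0 // => i _; exact: sqnorm_ge0.
Qed.

(** * The inner product *)

Definition l2dot (x y : l2) : C := csum (fun k => x k * (y k)^*).

(** Both parts of each term are at most the sum of the two squared moduli in absolute value, so both
    real series converge absolutely. *)
Lemma l2dot_summable (x y : l2) : csummable (fun k => x k * (y k)^*).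
Proof.
have H (f : nat -> R) : (forall k, `|f k| <= sqnorm (x k) + sqnorm (y k)) ->
    cvgn (series f).
  move=> fxy; apply: normed_cvg.
  apply: (@series_le_cvg _ _ (fun k => sqnorm (x k) + sqnorm (y k))) => //.
  - by move=> n /=.
  - by move=> n /=; rewrite addr_ge0 ?sqnorm_ge0.
  - by apply: is_cvg_seriesD; exact: l2_cvg.
split; apply: H => k; case: (x k) (y k) => a b [c d];
  rewrite /sqnorm /= ler_norml.
  by have := sqr_ge0 (a - c); have := sqr_ge0 (b - d); have := sqr_ge0 (a + c);
    have := sqr_ge0 (b + d) => *; apply/andP; split; nra.
by have := sqr_ge0 (a - d); have := sqr_ge0 (b - c); have := sqr_ge0 (a + d);
    have := sqr_ge0 (b + c) => *; apply/andP; split; nra.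
Qed.

Lemma l2dotxx (x : l2) : l2dot x x = (l2sq x)%:C%C.
Proof.
rewrite /l2dot /csum; apply/eqP; rewrite eq_complex/=.
apply/andP; split; apply/eqP.
  congr (limn (series _)); apply/funext => k; case: (x k) => a b.
  by rewrite /sqnorm/=; ring.
rewrite (_ : (fun k => _) = fun=> 0).
  rewrite (_ : series _ = fun=> 0) ?lim_cst //.
  by apply/funext => n; rewrite /series/= big1.
by apply/funext => k; case: (x k) => a b /=; ring.
Qed.

Lemma l2dotC (x y : l2) : l2dot x y = (l2dot y x)^*.
Proof.
rewrite /l2dot /csum; apply/eqP; rewrite eq_complex/=.
apply/andP; split; apply/eqP.
  congr (limn (series _)); apply/funext => k.
  by case: (x k) (y k) => a b [c d] /=; ring.
have [_ c] := l2dot_summable y x.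
rewrite -(limN c); congr (limn _); apply/funext => n.
rewrite -[RHS]/(- series _ n) /series/= -sumrN.
by apply: eq_bigr => k _; case: (x k) (y k) => a b [? ?] /=; ring.
Qed.

Lemma l2dot_linearl (z : l2) : linear_for *%R (l2dot^~ z).
Proof.
move=> a x y; have [_ <-] := csumP a (l2dot_summable x z) (l2dot_summable y z).
by congr csum; apply/funext => k; rewrite [LHS]mulrDl mulrA.
Qed.

Lemma l2dot_linearr (z : l2) : linear_for (@Num.conj C \; *%R) (l2dot z).
Proof.
move=> a x y; rewrite l2dotC l2dot_linearl rmorphD rmorphM /=.
by rewrite -!l2dotC.
Qed.

HB.instance Definition _ := bilinear_isBilinear.Build C l2 l2 C
  *%R (@Num.conj C \; *%R) l2dot (l2dot_linearl, l2dot_linearr).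

HB.instance Definition _ := isHermitianSesquilinear.Build C l2 false
  (@Num.conj C) l2dot
  (fun x y => etrans (l2dotC x y) (esym (mul1r _))).

Lemma l2dot_gt0 (x : l2) : x != 0 -> 0 < l2dot x x.
Proof.
rewrite l2dotxx ltcR lt0r l2sq_ge0 andbT; apply: contra => /eqP x0.
apply/eqP/l2_ext => k; apply/eqP; rewrite -sqnorm_eq0.
by rewrite eq_le sqnorm_ge0 -{1}x0 l2sq_coord.
Qed.

HB.instance Definition _ := isDotProduct.Build C l2 l2dot l2dot_gt0.


(** * The norm and completeness *)

Definition l2norm (x : l2) : C := sqrtC (l2dot x x).

Lemma l2norm_triangle (x y : l2) : l2norm (x + y) <= l2norm x + l2norm y.
Proof. exact: dot_triangle. Qed.

Lemma l2normZ (a : C) (x : l2) : l2norm (a *: x) = `|a| * l2norm x.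
Proof.
rewrite /l2norm dnormZ sqrtCM ?nnegrE ?exprn_ge0 ?dnorm_ge0 //.
by rewrite sqrCK.
Qed.

Lemma l2norm_eq0 (x : l2) : l2norm x = 0 -> x = 0.
Proof. by move/eqP; rewrite sqrtC_eq0 dnorm_eq0 => /eqP. Qed.

HB.instance Definition _ := Lmodule_isNormed.Build C l2
  l2norm_triangle l2normZ l2norm_eq0.

Lemma l2_normE (x : l2) : `|x| ^+ 2 = l2dot x x.
Proof. by rewrite [`|x|]/(l2norm x) sqrtCK. Qed.

Lemma l2_norm_lt (x : l2) (e : R) : 0 <= e ->
  (`|x| < e%:C%C) = (l2sq x < e ^+ 2).
Proof.
move=> e0; rewrite -(@ltr_pXn2r _ 2) ?nnegrE ?ler0c //.
by rewrite l2_normE l2dotxx -rmorphXn ltcR.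
Qed.

Lemma l2_norm_le (x : l2) (e : R) : 0 <= e ->
  (`|x| <= e%:C%C) = (l2sq x <= e ^+ 2).
Proof.
move=> e0; rewrite -(@ler_pXn2r _ 2) ?nnegrE ?ler0c //.
by rewrite l2_normE l2dotxx -rmorphXn lecR.
Qed.

Lemma complex_gt0P (e : C) : 0 < e -> exists2 r : R, 0 < r & e = r%:C%C.
Proof. by case: e => a b; rewrite ltcE /= => /andP[/eqP -> a0]; exists a. Qed.

(** Each coordinate is controlled by the norm, hence converges along [F]. Bounds on finite partial
    sums survive this coordinatewise limit, which puts the limit sequence in l2 and gives
    convergence in norm. *)
Lemma l2_complete (F : set_system l2) : ProperFilter F -> cauchy F -> cvg F.
Proof.
move=> FF Fc.
have Fball (e : R) : 0 < e -> exists x : l2, F (fun y => l2sq (x - y) < e ^+ 2).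
  move=> e0; have := (@cauchyP C l2 F _).1 Fc e%:C%C.
  rewrite ltcR => /(_ _ e0)[x xF]; exists x; apply: filterS xF => y.
  by rewrite -ball_normE /= l2_norm_lt // ltW.
(* [p] stands for [Re] or [Im]. *)
have coord_cvg (p : C -> R) : (forall z z', p (z - z') = p z - p z') ->
    (forall z, p z ^+ 2 <= sqnorm z) ->
    forall k, cvg ((fun y : l2 => p (y k)) @ F).
  move=> pB p_le k; apply: R_complete; apply: cauchy_exP => e e0.
  have [x xF] := Fball e e0; exists (p (x k)).
  suff : F (fun y => `|p (x k) - p (y k)| < e).
    by rewrite -ball_normE.
  apply: filterS xF => y xy; rewrite -(@ltr_pXn2r _ 2) ?nnegrE ?(ltW e0) //.
  rewrite real_normK ?num_real // -pB.
  apply: le_lt_trans (p_le _) _.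
  by apply: le_lt_trans (l2sq_coord (x - y) k) xy.
have Re_cvg k : cvg ((fun y : l2 => Re (y k)) @ F).
  apply: coord_cvg => [[a b] [c d] //|z]; by rewrite lerDl sqr_ge0.
have Im_cvg k : cvg ((fun y : l2 => Im (y k)) @ F).
  apply: coord_cvg => [[a b] [c d] //|z]; by rewrite lerDr sqr_ge0.
pose l k : C := (lim ((fun y : l2 => Re (y k)) @ F) +i*
                 lim ((fun y : l2 => Im (y k)) @ F))%C.
(* For fixed [n] the sum is finite, so [y] may be sent to [l] along [F] term by term. *)
have near_l (x : l2) (e : R) : F (fun y => l2sq (x - y) < e ^+ 2) -> forall n,
    \sum_(0 <= k < n) sqnorm (x k - l k) <= e ^+ 2.
  move=> xF n.
  have c : (fun y : l2 => \sum_(0 <= k < n) sqnorm (x k - y k)) @ F -->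
      \sum_(0 <= k < n) sqnorm (x k - l k).
    apply: cvg_big; first exact: add_continuous.
    move=> k _; rewrite /sqnorm.
    have E (f : C -> R) : (forall z z', f (z - z') = f z - f z') ->
        cvg ((fun y : l2 => f (y k)) @ F) ->
      (fun y : l2 => f (x k - y k) ^+ 2) @ F -->
      (f (x k) - lim ((fun y : l2 => f (y k)) @ F)) ^+ 2.
      move=> fB fc; under eq_fun do rewrite fB expr2.
      by rewrite expr2; apply: cvgM; apply: cvgB => //; exact: cvg_cst.
    have -> : Re (x k - l k) = Re (x k) - Re (l k) by case: (x k).
    have -> : Im (x k - l k) = Im (x k) - Im (l k) by case: (x k).
    by apply: cvgD; apply: E => // [[a b] [c d]].
  rewrite -(cvg_lim _ c) //; apply: limr_le.
    by apply/cvg_ex; eexists; exact: c.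
  apply: filterS xF => y /ltW; apply: le_trans.
  exact: (l2sq_partial (x - y) n).
have [x0 /near_l/l2_of_bounded[x0l _]] := Fball 1 ltr01.
have l_l2 : l \in l2_pred.
  (* Only [x0 - l] is known to be square-summable so far; [l] is recovered as a difference. *)
  rewrite (_ : l = l2val x0 - (fun k => x0 k - l k)).
    by rewrite rpredB // l2valP.
  by apply/funext => k; rewrite /= [RHS]subKr.
apply/cvg_ex; exists (L2 l_l2); apply/cvgrPdist_le => e /complex_gt0P[r r0 ->].
have r20 : 0 < r / 2 by rewrite divr_gt0.
have [x xF] := Fball _ r20; apply: filterS (xF) => y xy.
have -> : L2 l_l2 - y = (L2 l_l2 - x) + (x - y) by rewrite addrA subrK.
apply: le_trans (ler_normD _ _) _.
rewrite (splitr r) rmorphD lerD //.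
  rewrite distrC l2_norm_le ?(ltW r20) //; apply: l2sq_le => n.
  exact: near_l xF n.
by rewrite l2_norm_le ?(ltW r20) ?(ltW xy).
Qed.

HB.instance Definition _ := Uniform_isComplete.Build l2 l2_complete.

Definition l2hilbert : hilbertType R := HilbertType l2_normE.

End l2.

(** * The Rolewicz operator *)

Section Rolewicz.
Variable R : realType.
Local Notation C := R[i].
Local Notation l2 := (l2 R).

Lemma sqnorm_real (r : R) : sqnorm r%:C%C = r ^+ 2.
Proof. by rewrite /sqnorm /= expr0n addr0. Qed.

(** The shift only drops a nonnegative term. The factor 16 is kept as [2 ^+ 4], so that later
    estimates compare exponents of 2. *)
Lemma rolewicz_subproof (x : l2) :
  (fun k => (2 ^+ 4)%:C%C * x k.+1) \in @l2_pred R /\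
  limn (series (fun k => sqnorm ((2 ^+ 4)%:C%C * x k.+1))) <=
    (2 ^+ 4) ^+ 2 * l2sq x.
Proof.
apply: l2_of_bounded => n; under eq_bigr do rewrite sqnormM sqnorm_real.
rewrite -mulr_sumr ler_pM2l ?exprn_gt0 //.
apply: le_trans (l2sq_partial x n.+1); rewrite big_nat_recl //= lerDr.
exact: sqnorm_ge0.
Qed.

Definition rolewicz (x : l2) : l2 := L2 (proj1 (rolewicz_subproof x)).

Lemma rolewicz_linear : linear rolewicz.
Proof.
by move=> a x y; apply: l2_ext => k /=; rewrite mulrDr mulrCA.
Qed.

HB.instance Definition _ := GRing.isLinear.Build C l2 l2 *:%R rolewicz
  rolewicz_linear.

Lemma rolewicz_bounded : bounded_operator rolewicz.
Proof.
exists (2 ^+ 4)%:C%C => x.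
rewrite -(@ler_pXn2r _ 2) ?nnegrE ?mulr_ge0 ?ler0c ?exprn_ge0 //.
rewrite exprMn !l2_normE !l2dotxx -(rmorphXn (real_complex R)) -rmorphM lecR.
exact: (proj2 (rolewicz_subproof x)).
Qed.

Lemma iter_rolewicz n (x : l2) k :
  iter n rolewicz x k = (2 ^+ (4 * n))%:C%C * x (n + k)%N.
Proof.
elim: n k => [|n IH] k; first by rewrite muln0 mul1r.
by rewrite iterS /= IH mulrA -rmorphM -exprD mulnS addnS.
Qed.

Lemma iter_rolewiczZ n a (x : l2) :
  iter n rolewicz (a *: x) = a *: iter n rolewicz x.
Proof. by elim: n => // n IH; rewrite !iterS IH linearZ. Qed.

(** * The hypercyclic vector and its size estimates *)

Definition ratc (q : rat * rat) : C := (ratr q.1 +i* ratr q.2)%C.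

(* The second component of a code is padding, so that every sequence occurs for
   arbitrarily large [l]; entries too large for the geometric bounds below are
   replaced by 0. *)
Definition code_entry (l j : nat) : C :=
  if (unpickle l : option (seq (rat * rat) * nat)) is Some (w, _) then
    let z := ratc (nth (0, 0) w j) in
    if sqnorm z <= 2 ^+ (2 * l) :> R then z else 0
  else 0.

Lemma sqnorm_code_entry l j : sqnorm (code_entry l j) <= 2 ^+ (2 * l).
Proof.
have sq0 : sqnorm (0 : C) <= 2 ^+ (2 * l).
  by rewrite (sqnorm_real 0) expr0n exprn_ge0.
by rewrite /code_entry; case: unpickle => [[w p]|//]; case: ifP.
Qed.

(** Index 0 lies in no block; since [trunc_log 2 0 = 0] and subtraction is truncated, it merely
    repeats the value at index 1. *)
Definition hypercyclic_coord (i : nat) : C :=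
  let l := trunc_log 2 i in
  ((2 ^+ (4 * 2 ^ l))^-1)%:C%C * code_entry l (i - 2 ^ l).

Lemma trunc_log2_lt i : (i < 2 ^ (trunc_log 2 i).+1)%N.
Proof. by case: i => // i; have /andP[] := @trunc_log_bounds 2 i.+1 isT isT. Qed.

Lemma sqnorm_hypercyclic_coord i :
  sqnorm (hypercyclic_coord i) <= (2 ^+ i)^-1.
Proof.
rewrite /hypercyclic_coord sqnormM sqnorm_real; set l := trunc_log 2 i.
have := trunc_log2_lt i; rewrite -/l expnS => il.
have l_lt : (l < 2 ^ l)%N by exact: ltn_expl.
apply: (@le_trans _ _ ((2 ^+ (4 * 2 ^ l))^-1 ^+ 2 * 2 ^+ (2 * l))).
  by rewrite ler_wpM2l ?sqr_ge0 ?sqnorm_code_entry.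
rewrite exprVn -exprM ler_pdivrMl ?exprn_gt0 //.
rewrite -ler_pdivrMr ?invr_gt0 ?exprn_gt0 //.
(* The exponents satisfy 2l + i < 4 * 2^l, from l < 2^l and i < 2 * 2^l. *)
rewrite invrK -exprD ler_eXn2l ?ltr1n //; lia.
Qed.

(** The index [2 ^ k + i] lies in a later block [l], with 2 * 2^k <= 2^l. The growth 2^(8 * 2^k)
    then uses at most half of the decay 2^(-8 * 2^l), and the remaining 2^(-4 * 2^l) absorbs both
    the entry size 2^(2l) and 2^(2^k + i). *)
Lemma sqnorm_rolewicz_tail k i : (2 ^ k <= i)%N ->
  sqnorm ((2 ^+ (4 * 2 ^ k))%:C%C * hypercyclic_coord (2 ^ k + i)) <=
    (2 ^+ (2 ^ k + i))^-1.
Proof.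
rewrite /hypercyclic_coord !sqnormM !sqnorm_real; set l := trunc_log 2 _ => ki.
have := trunc_log2_lt (2 ^ k + i); rewrite -/l expnS => il.
have l_lt : (l < 2 ^ l)%N by exact: ltn_expl.
have kl : (2 * 2 ^ k <= 2 ^ l)%N.
  by rewrite -expnS leq_exp2l // trunc_log_max // expnS; lia.
apply: (@le_trans _ _ ((2 ^+ (4 * 2 ^ k)) ^+ 2 *
    ((2 ^+ (4 * 2 ^ l))^-1 ^+ 2 * 2 ^+ (2 * l)))).
  by rewrite !ler_wpM2l ?sqr_ge0 ?sqnorm_code_entry.
rewrite exprVn -!exprM mulrCA ler_pdivrMl ?exprn_gt0 //.
rewrite -ler_pdivrMr ?invr_gt0 ?exprn_gt0 //.
rewrite invrK -!exprD ler_eXn2l ?ltr1n //; lia.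
Qed.

Lemma sum_geometric2_le n : \sum_(0 <= k < n) (2 ^+ k)^-1 <= 2 :> R.
Proof.
suff -> : \sum_(0 <= k < n) (2 ^+ k)^-1 = 2 - 2 * (2 ^+ n)^-1 :> R.
  by rewrite gerBl mulr_ge0 // invr_ge0 exprn_ge0.
elim: n => [|n IH]; first by rewrite big_geq // expr0 invr1 mulr1 subrr.
rewrite big_nat_recr //= IH exprS invfM.
by field; rewrite expf_neq0.
Qed.

Lemma hypercyclic_subproof : hypercyclic_coord \in @l2_pred R.
Proof.
apply: (proj1 (@l2_of_bounded _ _ 2 _)) => n.
apply: le_trans (sum_geometric2_le n).
by apply: ler_sum => i _; exact: sqnorm_hypercyclic_coord.
Qed.

Definition hypercyclic_vector : l2 := L2 hypercyclic_subproof.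

(** * Approximation and density of the orbit *)

Lemma pickle_pair_unbounded (T : countType) (w : T) (N : nat) :
  exists p : nat, (N <= pickle (w, p))%N.
Proof.
(* Pigeonhole: otherwise the injective [pickle] would send N + 1 pairs below [N]. *)
apply: contrapT => /forallNP H.
have lt (i : 'I_N.+1) : (pickle (w, nat_of_ord i) < N)%N.
  by rewrite ltnNge; apply/negP; exact: H.
pose f i := Ordinal (lt i).
have f_inj : injective f.
  move=> i j /(congr1 val)/= /(pcan_inj pickleK) [ij]; exact: val_inj.
by have := leq_card f f_inj; rewrite !card_ord ltnn.
Qed.

Lemma rat_approx (z : C) (e : R) : 0 < e ->
  exists q : rat * rat, sqnorm (ratc q - z) <= e.
Proof.
(* If 0 <= s <= r then s^2 <= s <= e / 2, since r <= 1. *)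
move=> e0; case: z => a b; pose r := Num.min 1 (e / 2).
have r0 : 0 < r by rewrite lt_min ltr01 divr_gt0.
have near (c : R) : exists q : rat, (ratr q - c) ^+ 2 <= e / 2.
  have [q] := @rat_in_itvoo _ c (c + r) ltac:(by rewrite ltrDl).
  rewrite in_itv /= => /andP[cq qc]; exists q.
  have s0 : 0 <= ratr q - c by rewrite subr_ge0 ltW.
  have sr : ratr q - c <= r by rewrite lerBlDl ltW.
  have : r <= 1 by rewrite ge_min lexx.
  have : r <= e / 2 by rewrite ge_min lexx orbT.
  by nra.
have [qa qaP] := near a; have [qb qbP] := near b.
by exists (qa, qb); rewrite /sqnorm /= [leRHS](splitr e) lerD.
Qed.

(** The tail is a filtered sum from 0, so that it can be added to full partial sums in
    [hypercyclicP]. *)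
Lemma l2_tail (x : l2) (e : R) : 0 < e -> exists N, forall m,
  \sum_(0 <= k < m | (N <= k)%N) sqnorm (x k) <= e.
Proof.
move=> e0.
have c : series (fun k => sqnorm (x k)) @ \oo --> l2sq x by exact: l2_cvg.
move/cvgrPdist_le: c => /(_ e e0) [N _ NP].
exists N => m; have := NP N (leqnn N).
have [mN|Nm] := leqP m N.
  rewrite big_nat_cond big1 ?(ltW e0) // => k; lia.
have -> : \sum_(0 <= k < m | (N <= k)%N) sqnorm (x k) =
    \sum_(N <= k < m) sqnorm (x k).
  rewrite (big_cat_nat (leq0n N) (ltnW Nm)) /= big_nat_cond.
  rewrite big1 ?add0r; last by move=> k; lia.
  by rewrite big_nat_cond [RHS]big_nat_cond; apply: eq_bigl => k; lia.
rewrite -/(l2sq x) /series /= => Nx.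
have := l2sq_partial x m; rewrite (big_cat_nat (leq0n N) (ltnW Nm)) /=.
by have := ler_norm (l2sq x - \sum_(0 <= k < N) sqnorm (x k)); lra.
Qed.

Lemma pow2_inv_small (e : R) : 0 < e ->
  exists N, forall n, (N <= n)%N -> (2 ^+ n)^-1 <= e.
Proof.
move=> e0; exists (Num.bound e^-1) => n Nn.
by rewrite invf_ple ?posrE ?exprn_gt0 // ltW // upper_nthrootP.
Qed.

Lemma hypercyclicP (y : l2) (e : R) : 0 < e ->
  exists n, l2sq (iter n rolewicz hypercyclic_vector - y) <= e.
Proof.
(* The final estimate is 2d * 2 for the geometric errors plus 2d for the tail of [y]. *)
move=> e0; pose d := e / 6; have d0 : 0 < d by rewrite divr_gt0.
have [N yN] := l2_tail y d0.
have /choice[q qP] : forall i, exists q : rat * rat,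
    sqnorm (ratc q - y i) <= d * (2 ^+ i)^-1.
  by move=> i; apply: rat_approx; rewrite mulr_gt0 // invr_gt0 exprn_gt0.
pose w := mkseq q N.
have [K KP] := pow2_inv_small d0.
(* [M] makes the chosen rational entries pass the size test of [code_entry]. *)
have [M MP] : exists M, forall i, (i < N)%N ->
    sqnorm (ratc (q i)) <= 2 ^+ M.
  exists (\max_(i < N) Num.bound (sqnorm (ratc (q i)))) => i iN.
  by apply/ltW/upper_nthrootP; exact: (leq_bigmax (Ordinal iN)).
(* Padding makes the code [k] large: [N] lets the sequence fit in block [k], [K] makes 2^(-2^k) at
   most [d]. *)
have [p pP] := pickle_pair_unbounded w (N + K + M).
set k := pickle (w, p) in pP; exists (2 ^ k)%N.
have k_lt : (k < 2 ^ k)%N by exact: ltn_expl.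
(* These coordinates read block [k] exactly, and the scalings cancel; past [N] the default of [nth]
   gives 0. *)
have head i : (i < 2 ^ k)%N -> iter (2 ^ k) rolewicz hypercyclic_vector i =
    if (i < N)%N then ratc (q i) else 0.
  move=> ik; rewrite iter_rolewicz /= /hypercyclic_coord.
  rewrite (@trunc_log_eq 2 k) ?leq_addr ?expnS ?mul2n -?addnn ?ltn_add2l //.
  rewrite addKn mulrA -rmorphM mulfV ?expf_neq0 // rmorph1 mul1r.
  rewrite /code_entry pickleK /w; case: ltnP => iN.
    rewrite nth_mkseq // ifT //; apply: le_trans (MP i iN) _.
    by rewrite ler_eXn2l ?ltr1n //; lia.
  rewrite nth_default ?size_mkseq // /ratc !rmorph0 /=.
  by case: ifP.
(* Three ranges: rational approximation for i < N, only [y] for N <= i < 2^k, and [y] plus the later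
   blocks for i >= 2^k. *)
have bound i : sqnorm ((iter (2 ^ k) rolewicz hypercyclic_vector - y) i) <=
    2 * d * (2 ^+ i)^-1 + 2 * (if (N <= i)%N then sqnorm (y i) else 0).
  rewrite -[l2val _ i]/(iter (2 ^ k) rolewicz hypercyclic_vector i - y i).
  have i0 : 0 <= (2 ^+ i)^-1 :> R by rewrite invr_ge0 exprn_ge0.
  have di0 := mulr_ge0 (ltW d0) i0; have y0 := sqnorm_ge0 (y i).
  have [ik|ki] := ltnP i (2 ^ k).
    rewrite head //; case: ltnP => iN; first by have := qP i; lra.
    by rewrite add0r sqnormN; lra.
  rewrite ifT; last by lia.
  apply: le_trans (sqnormD _ _) _; rewrite sqnormN lerD2r -mulrA ler_pM2l //.
  rewrite iter_rolewicz; apply: le_trans (sqnorm_rolewicz_tail ki) _.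
  rewrite exprD invfM ler_wpM2r //; apply: KP; lia.
apply: l2sq_le => m; apply: le_trans (ler_sum _ (fun i _ => bound i)) _.
rewrite big_split /= -!mulr_sumr -big_mkcond /=.
have := yN m; have := sum_geometric2_le m => s1 s2.
have : d * \sum_(0 <= i < m) (2 ^+ i)^-1 <= d * 2 by rewrite ler_pM2l.
have : e = 6 * d by rewrite /d; field.
by move=> ->; rewrite -mulrA; lra.
Qed.

End Rolewicz.

(** * The second operator and minimality *)

Section Operators.
Variable R : realType.
Local Notation C := R[i].
Local Notation l2 := (l2 R).

Lemma sqr_normc_sqnorm (z : C) : `|z| ^+ 2 = (sqnorm z)%:C%C.
Proof. by rewrite -add_Re2_Im2. Qed.

Lemma l2sqZ (c : C) (x : l2) : l2sq (c *: x) = sqnorm c * l2sq x.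
Proof.
apply: complexI; rewrite -l2dotxx dnormZ rmorphM /= -l2dotxx.
by rewrite sqr_normc_sqnorm.
Qed.

Lemma l2_coord_norm_le (x : l2) k : `|x k| <= `|x|.
Proof.
rewrite -(@ler_pXn2r _ 2) ?nnegrE // sqr_normc_sqnorm l2_normE l2dotxx lecR.
exact: l2sq_coord.
Qed.

Lemma hypercyclic_dense (c : C) : c != 0 ->
  dense (range (fun n => c *: iter n (@rolewicz R) (hypercyclic_vector R))).
Proof.
move=> c0 O [y Oy] Oo.
have /nbhs_ballP[e /= e0 yO] := open_nbhs_nbhs (conj Oo Oy).
have [r r0 er] := complex_gt0P e0.
have sc0 : 0 < sqnorm c by rewrite lt0r sqnorm_ge0 sqnorm_eq0 c0.
(* Scaling by [c] turns this error into r^2 / 2; the 2 restores the strict inequality required by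
   the open ball. *)
have d0 : 0 < r ^+ 2 / (2 * sqnorm c) by rewrite divr_gt0 ?exprn_gt0 ?mulr_gt0.
have [n nP] := hypercyclicP (c^-1 *: y) d0.
exists (c *: iter n (@rolewicz R) (hypercyclic_vector R)).
split; last by exists n.
apply: yO; rewrite -ball_normE /= er distrC l2_norm_lt ?(ltW r0) //.
have -> : c *: iter n (@rolewicz R) (hypercyclic_vector R) - y =
    c *: (iter n (@rolewicz R) (hypercyclic_vector R) - c^-1 *: y).
  by rewrite scalerBr scalerA mulfV // scale1r.
rewrite l2sqZ mulrC -ltr_pdivlMr //; apply: le_lt_trans nP _.
by rewrite ltr_pM2l ?exprn_gt0 // ltf_pV2 ?posrE ?mulr_gt0 // ltr_pMl ?ltr1n.
Qed.

Definition coord0_hypercyclic (x : l2) : l2 := x 0%N *: hypercyclic_vector R.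

Lemma coord0_hypercyclic_linear : linear coord0_hypercyclic.
Proof. by move=> a x y; rewrite /coord0_hypercyclic scalerDl scalerA. Qed.

HB.instance Definition _ := GRing.isLinear.Build C l2 l2 *:%R
  coord0_hypercyclic coord0_hypercyclic_linear.

Lemma coord0_hypercyclic_bounded : bounded_operator coord0_hypercyclic.
Proof.
exists `|hypercyclic_vector R| => x; rewrite normrZ mulrC ler_wpM2l //.
exact: l2_coord_norm_le.
Qed.

Lemma rolewicz_coord0_minimal : minimal (@rolewicz R) coord0_hypercyclic.
Proof.
move=> x x0 O On0 Oo.
have [j xj] : exists j, x j != 0.
  apply: contrapT => /forallNP H; move/eqP: x0; apply; apply: l2_ext => k.
  by apply/eqP/negPn/negP; exact: H.
(* This scalar is coordinate 0 of [iter j rolewicz x], which the second operator extracts. *)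
have c0 : (2 ^+ (4 * j))%:C%C * x j != 0.
  rewrite mulf_neq0 //; apply/eqP => /complexI /eqP.
  by rewrite expf_eq0 pnatr_eq0 andbF.
have [z [Oz [n _ zE]]] := hypercyclic_dense c0 On0 Oo.
(* The last letters act first: j shifts, then the rank-one operator, then n shifts. *)
pose w : seq bool := nseq n false ++ true :: nseq j false.
have w0 : w != [::] by rewrite /w; case: (n).
exists z; split; first exact: Oz.
exists (exist _ w w0) => //; rewrite -zE /rho /= /w foldr_cat /=.
have foldr_nseq m y0 : foldr (fun (b : bool) y =>
    if b then coord0_hypercyclic y else rolewicz y) y0 (nseq m false) =
    iter m (@rolewicz R) y0 by elim: m => //= m ->.
rewrite !foldr_nseq /coord0_hypercyclic iter_rolewiczZ iter_rolewicz addn0.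
by [].
Qed.

(** * Separability and infinite dimension *)

Lemma l2_separable : separable l2.
Proof.
(* The hypercyclic orbit is itself a countable dense set; the factor 1 matches
   [hypercyclic_dense]. *)
exists (range (fun n => 1 *: iter n (@rolewicz R) (hypercyclic_vector R))).
  exact: card_image_le.
exact: hypercyclic_dense (oner_neq0 _).
Qed.

Lemma delta_subproof (j : nat) : (fun k => (k == j)%:R : C) \in @l2_pred R.
Proof.
apply: (proj1 (@l2_of_bounded _ _ 1 _)) => n.
have E k : sqnorm ((k == j)%:R : C) = (k == j)%:R.
  by case: eqP => _; rewrite /sqnorm /= !expr0n ?expr1n ?addr0.
under eq_bigr do rewrite E.
have [jn|nj] := ltnP j n.
  rewrite (bigD1_seq j) ?mem_index_iota ?iota_uniq //= eqxx big1 ?addr0 //.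
  by move=> i /negbTE ->.
rewrite big_nat big1 // => i /andP[_ ij].
by rewrite ltn_eqF // (leq_trans ij).
Qed.

(** If n vectors spanned, expanding n + 1 unit vectors in them and reading the first n + 1
    coordinates would factor the identity matrix of size n + 1 through dimension n, against its
    rank. *)
Lemma l2_infinite_dimensional : ~ finite_dimensional l2.
Proof.
move=> [n [e eP]].
have /choice[a aP] : forall k : 'I_n.+1, exists a : 'I_n -> C,
    L2 (delta_subproof k) = \sum_(i < n) a i *: e i by move=> k; exact: eP.
pose D := \matrix_(k < n.+1, i < n) a k i.
pose E := \matrix_(i < n, k < n.+1) e i k.
have DE : 1%:M = D *m E.
  apply/matrixP => k k'; rewrite !mxE.
  have /(congr1 (fun x : l2 => x k')) /= := aP k.
  rewrite (big_morph (fun x : l2 => x k') (id1 := 0) (op1 := +%R)) //.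
  rewrite -val_eqE eq_sym => ->.
  by apply: eq_bigr => i _; rewrite !mxE.
have : (\rank (1%:M : 'M[C]_n.+1) <= n)%N.
  by rewrite DE (leq_trans (mulmx_max_rank _ _)).
by rewrite mxrank1 ltnn.
Qed.

End Operators.

Theorem corollary1p2 (R : realType) :
  exists H : hilbertType R,
    [/\ separable H, ~ finite_dimensional H &
      exists T0 T1 : {linear H -> H},
        [/\ bounded_operator T0, bounded_operator T1 & minimal T0 T1]].
Proof.
exists (l2hilbert R); split; [exact: l2_separable|exact: l2_infinite_dimensional|].
exists (@rolewicz R), (@coord0_hypercyclic R).
split; [exact: rolewicz_bounded|exact: coord0_hypercyclic_bounded|].
exact: rolewicz_coord0_minimal.
Qed.
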